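(* Let $M$ be a smooth manifold with an integrable Born structure $(g,h,\omega)$ with recursion operators $A,B,J$, and let $\nabla^K$ be the Künneth connection of the underlying almost Künneth structure $(\omega,L_+,L_-)$. Then the connection $\nabla$ defined by $$\nabla_X Y=\tfrac12\left(\nabla^K_X Y+B\nabla^K_X(BY)\right)=\tfrac12\left(\nabla^K_X Y-J\nabla^K_X(JY)\right),\qquad X,Y\in\mathfrak{X}(M),$$ agrees with the Born connection $\nabla^B$ of $(g,h,\omega)$.
   Context: A Born structure on a smooth manifold $M$ is a triple $(g,h,\omega)$ where $g,h$ are pseudo-Riemannian metrics (of any signature) and $\omega$ is a non-degenerate 2-form such that the endomorphism fields $A,B,J$ of $TM$ (the recursion operators) determined by $g(AX,Y)=\omega(X,Y)$, $g(BX,Y)=h(X,Y)$, $\omega(-JX,Y)=h(X,Y)$ satisfy $A^2=B^2=-J^2=\mathrm{Id}$. The subbundles $L_\pm$ are the $(\pm1)$-eigenbundles of $A$; they are complementary and $\omega$-isotropic, so $(\omega,L_+,L_-)$ is an almost Künneth structure (a non-degenerate 2-form with two complementary isotropic subbundles of $TM$), and $g(X,Y)=\omega(AX,Y)$ is its associated neutral metric. The Nijenhuis tensor of an endomorphism field $T$ is $N_T(X,Y)=[TX,TY]+T^2[X,Y]-T[TX,Y]-T[X,TY]$; a recursion operator is integrable if its Nijenhuis tensor vanishes. A Born structure is integrable if $\omega$ is closed and at least two (and therefore all) of $A,B,J$ are integrable. The Künneth connection $\nabla^K$ of an almost Künneth structure $(\omega,L_+,L_-)$ is the unique affine connection that preserves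 $L_+$ and $L_-$, satisfies $\nabla^K\omega=0$, and whose torsion $T^K$ satisfies $T^K(X,Y)=0$ for $X\in L_+$, $Y\in L_-$. The canonical connection is $\nabla^c_XY=\frac12(\nabla^g_XY+A\nabla^g_X(AY))$, where $\nabla^g$ is the Levi-Civita connection of $g$. A connection $\nabla$ is compatible with the Born structure if $\nabla g=\nabla h=\nabla\omega=0$. It has vanishing generalized torsion if $$g(\nabla_XY-\nabla_YX,Z)+g(\nabla_ZX,Y)=g(\nabla^c_XY-\nabla^c_YX,Z)+g(\nabla^c_ZX,Y)$$ for all $X,Y,Z\in\mathfrak X(M)$. By a known theorem of Freidel, Rudolph and Svoboda, there is a unique connection that is compatible with the Born structure and has vanishing generalized torsion; it is called the Born connection $\nabla^B$. *)

(* Defs.v *)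
From HB Require Import structures.
From mathcomp Require Import all_boot all_order all_algebra.
From mathcomp Require Import all_classical all_reals all_analysis.

Set Implicit Arguments.
Unset Strict Implicit.
Unset Printing Implicit Defensive.

Import Order.TTheory GRing.Theory Num.Theory numFieldNormedType.Exports.
Local Open Scope classical_set_scope.
Local Open Scope ring_scope.

Section SmoothOn.
Context {R : realType} {n : nat}.
Implicit Types (U : set 'rV[R]_n) (f g : 'rV[R]_n -> R).

(* f is of class C^k on U: it is continuous on U and, if k > 0, its partial
   derivatives exist on U and are of class C^(k-1). Used for U open only. *)
Fixpoint Ck U (k : nat) f : Prop :=
  (forall x, U x -> {for x, continuous f}) /\
  if k is k'.+1 then
    forall i : 'I_n, (forall x, U x -> derivable f x (delta_mx 0 i)) /\
                     Ck U k' (fun x => 'D_(delta_mx 0 i) f x)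
  else True.

Definition smooth_on U f := forall k, Ck U k f.

Lemma Ck_ext U k f g : open U -> (forall x, U x -> f x = g x) ->
  Ck U k f -> Ck U k g.
Proof.
move=> oU; elim: k f g => [|k IH] f g fg [cf df];
  have nfg x : U x -> \near x, f x = g x
    by move=> Ux; near=> y; apply: fg; near: y; exact: open_nbhs_nbhs.
all: have cg x : U x -> {for x, continuous g}.
- move=> Ux; rewrite /= /prop_for /continuous_at -fg//.
  by apply: cvg_trans (cf _ Ux); exact: (@near_eq_cvg _ _ (nbhs x)) (nfg _ Ux).
- by split.
- move=> Ux; rewrite /= /prop_for /continuous_at -fg//.
  by apply: cvg_trans (cf _ Ux); exact: (@near_eq_cvg _ _ (nbhs x)) (nfg _ Ux).
split=> // i; have [dfi ci] := df i; split=> [x Ux|].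
  exact: (near_eq_derivable (nfg _ Ux) (dfi _ Ux)).
by apply: IH ci => x Ux; apply: near_eq_derive; exact: nfg.
Unshelve. all: by end_near. Qed.

Lemma Ck_cont U k f : Ck U k f -> forall x, U x -> {for x, continuous f}.
Proof. by case: k => [|k] []. Qed.

Lemma Ck_pred U k f : Ck U k.+1 f -> Ck U k f.
Proof.
elim: k f => [|k IH] f [cf df]; first by split.
by split=> // i; have [? ci] := df i; split=> //; exact: IH.
Qed.

Lemma Ck_cst U k (c : R) : Ck U k (cst c).
Proof.
elim: k c => [|k IH] c; (split; first by move=> x _; exact: cst_continuous) => // i.
split=> [x _|]; first exact: derivable_cst.
rewrite [X in Ck _ _ X](_ : _ = cst 0); first exact: IH.
by apply/funext => x; rewrite derive_cst.
Qed.

Lemma CkB U k f g : open U -> Ck U k f -> Ck U k g -> Ck U k (f - g).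
Proof.
move=> oU; elim: k f g => [|k IH] f g [cf df] [cg dg].
  by split=> // x Ux; apply: continuousB; [exact: cf|exact: cg].
split=> [x Ux|i]; first by apply: continuousB; [exact: cf|exact: cg].
have [dfi ci] := df i; have [dgi ei] := dg i; split=> [x Ux|].
  by apply: derivableB; [exact: dfi|exact: dgi].
apply: Ck_ext (IH _ _ ci ei) => // x Ux.
by rewrite deriveB//; [exact: dfi|exact: dgi].
Qed.

Lemma CkD U k f g : open U -> Ck U k f -> Ck U k g -> Ck U k (f + g).
Proof.
move=> oU Cf Cg; rewrite (_ : f + g = f - (cst 0 - g)).
  by apply: CkB => //; apply: CkB => //; exact: Ck_cst.
by apply/funext => x; rewrite !fctE sub0r opprK.
Qed.

Lemma CkM U k f g : open U -> Ck U k f -> Ck U k g -> Ck U k (f * g).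
Proof.
move=> oU; elim: k f g => [|k IH] f g Cf Cg;
  have cf := Ck_cont Cf; have cg := Ck_cont Cg.
  by split=> // x Ux; apply: continuousM; [exact: cf|exact: cg].
split=> [x Ux|i]; first by apply: continuousM; [exact: cf|exact: cg].
have [dfi ci] := Cf.2 i; have [dgi ei] := Cg.2 i; split=> [x Ux|].
  by apply: derivableM; [exact: dfi|exact: dgi].
apply: Ck_ext (CkD oU (IH _ _ (Ck_pred Cf) ei) (IH _ _ (Ck_pred Cg) ci)) => //.
by move=> x Ux; rewrite deriveM//; [exact: dfi|exact: dgi].
Qed.

End SmoothOn.

Record chart (R : realType) (n : nat) (T : topologicalType) := Chart {
  chart_dom : set T;
  chart_map :> T -> 'rV[R]_n;
  chart_inv : 'rV[R]_n -> T;
  chart_dom_open : open chart_dom;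
  chart_img_open : open (chart_map @` chart_dom);
  chart_mapK : forall x, chart_dom x -> chart_inv (chart_map x) = x;
  chart_map_continuous : forall x, chart_dom x -> {for x, continuous chart_map};
  chart_inv_continuous : forall y, (chart_map @` chart_dom) y ->
    {for y, continuous chart_inv}
}.

(* smoothness of the transition map c' \o c^-1, component by component *)
Definition smooth_transition (R : realType) (n : nat) (T : topologicalType)
    (c c' : chart R n T) :=
  forall i : 'I_n, smooth_on (c @` (chart_dom c `&` chart_dom c'))
                             (fun y => c' (chart_inv c y) 0 i).

(* The atlas need not be maximal: it determines the same smooth functions as
   the maximal atlas containing it. *)
Record smooth_manifold (R : realType) (n : nat) := SmoothManifold {
  carrier :> topologicalType;
  mfd_hausdorff : hausdorff_space carrier;
  mfd_second_countable : @second_countable carrier;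
  atlas : set (chart R n carrier);
  atlas_cover : forall x, exists2 c, atlas c & chart_dom c x;
  atlas_smooth : forall c c', atlas c -> atlas c' -> smooth_transition c c'
}.

Section SmoothFunctions.
Context {R : realType} {n : nat} (M : smooth_manifold R n).

Definition is_smooth (f : M -> R) := forall c : chart R n M, atlas c ->
  smooth_on (c @` chart_dom c) (f \o chart_inv c).

Definition smooth_pred : {pred M -> R} := fun f => `[< is_smooth f >].

Fact smooth_subring : subring_closed smooth_pred.
Proof.
split=> [|f g /asboolP sf /asboolP sg|f g /asboolP sf /asboolP sg];
  apply/asboolP => c Ac k.
- exact: Ck_cst.
- exact: CkB (@chart_img_open _ _ _ c) (sf c Ac k) (sg c Ac k).
- exact: CkM (@chart_img_open _ _ _ c) (sf c Ac k) (sg c Ac k).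
Qed.

HB.instance Definition _ :=
  GRing.isSubringClosed.Build (M -> R) smooth_pred smooth_subring.

Record smooth_fun := SmoothFun {
  smooth_val :> M -> R;
  smooth_valP : smooth_val \in smooth_pred
}.

HB.instance Definition _ := [isSub for smooth_val].
HB.instance Definition _ := [Choice of smooth_fun by <:].
HB.instance Definition _ := GRing.SubChoice_isSubComPzRing.Build
  (M -> R) smooth_pred smooth_fun smooth_subring.

Fact cst_smooth (a : R) : cst a \in smooth_pred.
Proof. by apply/asboolP => c _ k; exact: Ck_cst. Qed.

Definition smooth_cst (a : R) := SmoothFun (cst_smooth a).

End SmoothFunctions.

Section VectorFields.
Context {R : realType} {n : nat} (M : smooth_manifold R n).
Local Notation C := (smooth_fun M).

Definition is_derivation (X : C -> C) :=
  (forall (a : R) (f k : C),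
     X (smooth_cst M a * f + k) = smooth_cst M a * X f + X k) /\
  (forall f k : C, X (f * k) = f * X k + k * X f).

Definition derivation_pred : {pred C -> C^o} := fun X => `[< is_derivation X >].

Fact derivation_submod : submod_closed derivation_pred.
Proof.
split=> [|h X Y /asboolP [lX dX] /asboolP [lY dY]]; apply/asboolP; split.
- move=> a f k; have E i : (0 : C -> C^o) i = 0 by [].
  by rewrite !E mulr0 addr0.
- move=> f k; have E i : (0 : C -> C^o) i = 0 by [].
  by rewrite !E !mulr0 addr0.
- move=> a f k; have E i : (h *: X + Y) i = h * X i + Y i by [].
  by rewrite !E lX lY !mulrDr addrACA (mulrCA h).
- move=> f k; have E i : (h *: X + Y) i = h * X i + Y i by [].
  by rewrite !E dX dY !mulrDr addrACA !(mulrCA h).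
Qed.

HB.instance Definition _ :=
  GRing.isSubmodClosed.Build C (C -> C^o) derivation_pred derivation_submod.

(* Vector fields on M, as the derivations of the R-algebra C^oo(M). *)
Record vector_field := VectorField {
  vf_val :> C -> C^o;
  vf_valP : vf_val \in derivation_pred
}.

HB.instance Definition _ := [isSub for vf_val].
HB.instance Definition _ := [Choice of vector_field by <:].
HB.instance Definition _ := [SubChoice_isSubLmodule of vector_field by <:].

Fact bracket_derivation (X Y : vector_field) :
  (fun f => X (Y f) - Y (X f) : C^o) \in derivation_pred.
Proof.
have /asboolP [lX dX] := vf_valP X; have /asboolP [lY dY] := vf_valP Y.
have aX f k : X (f + k) = X f + X k.
  by have := lX 1 f k; rewrite (_ : smooth_cst M 1 = 1) ?mul1r//; exact/val_inj.
have aY f k : Y (f + k) = Y f + Y k.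
  by have := lY 1 f k; rewrite (_ : smooth_cst M 1 = 1) ?mul1r//; exact/val_inj.
apply/asboolP; split=> [a f k|f k].
  by rewrite lY lX lX lY mulrBr opprD addrACA.
rewrite dX dY aX aY !dX !dY !mulrBr [X k * Y f]mulrC [X f * Y k]mulrC.
rewrite addrACA [X in _ - X]addrACA [X in _ - (_ + X)]addrC.
by rewrite [in LHS]opprD [LHS]addrACA subrr addr0 opprD addrACA.
Qed.

Definition lie_bracket (X Y : vector_field) : vector_field :=
  VectorField (bracket_derivation X Y).

End VectorFields.

(* Tensor fields are C^oo(M)-multilinear maps on vector fields; the value at p
   of a function-valued tensor is the value at p of the resulting function. *)
Section Tensors.
Context {R : realType} {n : nat} {M : smooth_manifold R n}.
Local Notation C := (smooth_fun M).
Local Notation VF := (vector_field M).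
Implicit Types (g h w : VF -> VF -> C) (T : {linear VF -> VF}) (X Y Z : VF).

Definition bilinear_form g :=
  (forall Y, scalar (g^~ Y)) /\ (forall X, scalar (g X)).

(* Non-degeneracy at every point p, where X_p = 0 iff (X f)(p) = 0 for all f.
   The forms considered are symmetric or alternating, so that the left kernel
   suffices. *)
Definition nondegenerate g := forall X (p : M),
  (forall Y, g X Y p = 0) -> forall f : C, X f p = 0.

Definition pseudo_riemannian g :=
  [/\ bilinear_form g, forall X Y, g X Y = g Y X & nondegenerate g].

Definition two_form w := bilinear_form w /\ forall X, w X X = 0.

Definition exterior_derivative w X Y Z : C :=
  X (w Y Z) + Y (w Z X) + Z (w X Y)
  - w (lie_bracket X Y) Z - w (lie_bracket Y Z) X - w (lie_bracket Z X) Y.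

Definition closed_form w := forall X Y Z, exterior_derivative w X Y Z = 0.

Definition nijenhuis T X Y : VF :=
  lie_bracket (T X) (T Y) + T (T (lie_bracket X Y))
  - T (lie_bracket (T X) Y) - T (lie_bracket X (T Y)).

Definition integrable_field T := forall X Y, nijenhuis T X Y = 0.

(* A, B, J are the recursion operators of (g, h, w); non-degeneracy makes them
   unique. *)
Record born_structure g h w (A B J : {linear VF -> VF}) : Prop := {
  born_g : pseudo_riemannian g;
  born_h : pseudo_riemannian h;
  born_w : two_form w;
  born_w_nondegenerate : nondegenerate w;
  born_A : forall X Y, g (A X) Y = w X Y;
  born_B : forall X Y, g (B X) Y = h X Y;
  born_J : forall X Y, w (- J X) Y = h X Y;
  born_AA : forall X, A (A X) = X;
  born_BB : forall X, B (B X) = X;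
  born_JJ : forall X, J (J X) = - X
}.

Definition integrable_born w (A B J : {linear VF -> VF}) :=
  closed_form w /\
  [\/ integrable_field A /\ integrable_field B,
      integrable_field A /\ integrable_field J |
      integrable_field B /\ integrable_field J].

(* Sections of the c-eigenbundle of T. *)
Definition eigenbundle T (c : R) : set VF :=
  [set X | T X = smooth_cst M c *: X].

End Tensors.

Section Connections.
Context {R : realType} {n : nat} {M : smooth_manifold R n}.
Local Notation C := (smooth_fun M).
Local Notation VF := (vector_field M).
Implicit Types (g h w : VF -> VF -> C) (A B J : {linear VF -> VF}).
Implicit Types (D : VF -> VF -> VF) (L : set VF) (X Y Z : VF).

(* D X Y stands for the covariant derivative of Y in the direction X. *)
Record affine_connection D : Prop := {
  connection_linear : forall Y, linear (D^~ Y);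
  connection_additive : forall X Y Z, D X (Y + Z) = D X Y + D X Z;
  connection_leibniz : forall X (f : C) Y, D X (f *: Y) = X f *: Y + f *: D X Y
}.

Definition torsion D X Y : VF := D X Y - D Y X - lie_bracket X Y.

Definition parallel D g :=
  forall X Y Z, X (g Y Z) = g (D X Y) Z + g Y (D X Z).

Definition preserves D L := forall X Y, L Y -> L (D X Y).

Definition levi_civita g D :=
  [/\ affine_connection D, parallel D g & forall X Y, torsion D X Y = 0].

Definition kunneth_connection w (Lp Lm : set VF) D :=
  [/\ affine_connection D, preserves D Lp, preserves D Lm, parallel D w &
      forall X Y, Lp X -> Lm Y -> torsion D X Y = 0].

Definition smooth_half : C := smooth_cst M 2^-1.

(* The canonical connection, in terms of the Levi-Civita connection Dg. *)
Definition canonical_connection A Dg X Y : VF :=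
  smooth_half *: (Dg X Y + A (Dg X (A Y))).

Definition vanishing_generalized_torsion g Dc D := forall X Y Z,
  g (D X Y - D Y X) Z + g (D Z X) Y = g (Dc X Y - Dc Y X) Z + g (Dc Z X) Y.

Definition compatible g h w D :=
  [/\ affine_connection D, parallel D g, parallel D h & parallel D w].

(* Dg is unique, being the Levi-Civita connection of g. *)
Definition born_connection g h w A D :=
  compatible g h w D /\
  exists2 Dg, levi_civita g Dg &
    vanishing_generalized_torsion g (canonical_connection A Dg) D.

End Connections.

(* Main.v *)
Require Import Defs.
From mathcomp Require Import all_boot all_order all_algebra.
From mathcomp Require Import all_classical all_reals all_analysis.
From mathcomp Require Import ring.
Import GRing.Theory Num.Theory Defs.
Local Open Scope ring_scope.

(** Write L_c, for c = 1 or -1, for the c-eigenbundle of A. The recursion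
    operators satisfy J = BA = -AB, so B exchanges L_+ and L_-, and J agrees
    with c B on L_c. A is g-skew and B is g-symmetric; in particular both L_c
    are g-isotropic ([eigenbundle_isotropic]).

    Any two of the three integrability conditions give, for X and Y in L_c,
      2 [X,Y] = B (1 - cA) ([BX,Y] + [X,BY])
    ([born_lie_bracket]); this single identity is all that is kept of
    integrability, besides the closedness of w. It makes L_c involutive, and
    then, dw being the cyclic sum of w(T(X,Y),Z) for every connection
    preserving w, the Künneth connection DK has no torsion. As DK commutes with
    A, it preserves g; so it is the Levi-Civita connection of g
    ([kunneth_levi_civita]) and is equal to the canonical connection
    ([kunneth_canonical]). Read with DK in place of the brackets, the identity
    says [X,Y] = B DK_X(BY) - B DK_Y(BX) on L_c, hence that the averaged
    connection D has no torsion on pairs of sections of the same L_c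
    ([born_average_torsion]).

    D commutes with A and B and preserves g, so it is compatible with the Born
    structure. For two g-connections D and D0 the difference tensor
    phi(X,Y,Z) = g(D_X Y - D0_X Y, Z) is skew in Y and Z, and equality of
    generalized torsions means that the cyclic sum of phi is zero. With
    D0 = DK, that sum vanishes as soon as two of its arguments lie in the same
    L_c, by the partial torsion-freeness of D and the isotropy of L_c. Among
    three signs two agree, so it always vanishes
    ([born_average_generalized_torsion]).

    Uniqueness ([born_connection_unique]): the difference S of two candidates
    commutes with A and B. On L_c the form h(S_X Y, Z) is symmetric in X, Y and
    skew in Y, Z, so it is zero, as in the uniqueness of the Levi-Civita
    connection; and B carries the result to the mixed case. *)

Set Implicit Arguments.
Unset Strict Implicit.
Unset Printing Implicit Defensive.

(** * Vector fields, bilinear forms and connections *)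

Section Calculus.
Context {R : realType} {n : nat} {M : smooth_manifold R n}.
Local Notation C := (smooth_fun M).
Local Notation VF := (vector_field M).
Implicit Types (g h w : VF -> VF -> C) (D : VF -> VF -> VF).
Implicit Types (X Y Z : VF) (f k : C) (c : R).

Lemma smooth_halfD : smooth_half + smooth_half = 1 :> C.
Proof.
by apply/val_inj/funext => x; rewrite [RHS](splitr 1) mul1r.
Qed.

Lemma half_double (V : lmodType C) (x : V) : smooth_half *: (x + x) = x.
Proof. by rewrite scalerDr -scalerDl smooth_halfD scale1r. Qed.

Lemma double_eq0 (V : lmodType C) (x : V) : x + x = 0 -> x = 0.
Proof. by move=> x0; rewrite -[x]half_double x0 scaler0. Qed.

Lemma smooth_cst1 : smooth_cst M 1 = 1.
Proof. exact/val_inj. Qed.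

Lemma smooth_cstN c : smooth_cst M (- c) = - smooth_cst M c.
Proof. exact/val_inj. Qed.

Lemma smooth_cst_sign c : c * c = 1 -> smooth_cst M c * smooth_cst M c = 1.
Proof. by move=> cc; apply/val_inj/funext => x /=; rewrite !fctE cc. Qed.

(** The eigenvalues of A are written as reals c with c * c = 1, so that both
    eigenbundles are treated by one argument. *)
Lemma sign_cases c : c * c = 1 -> c = 1 \/ c = -1.
Proof.
move=> cc; have := sqrf_eq1 c; rewrite expr2 cc eqxx.
by move=> /esym/orP[] /eqP->; [left|right].
Qed.

Lemma sign_eq_or_opp c c' : c * c = 1 -> c' * c' = 1 -> c' = c \/ c' = - c.
Proof.
by move=> /sign_cases[] -> /sign_cases[] ->; rewrite ?opprK; auto.
Qed.

Lemma vf_ext X Y : (forall f : C, X f = Y f) -> X = Y.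
Proof. by move=> XY; apply/val_inj/funext. Qed.

Lemma vf0 f : (0 : VF) f = 0 :> C. Proof. by []. Qed.
Lemma vfD X Y f : (X + Y) f = X f + Y f :> C. Proof. by []. Qed.
Lemma vfN X f : (- X) f = - X f :> C. Proof. by []. Qed.
Lemma vfZ X k f : (k *: X) f = k * X f :> C. Proof. by []. Qed.
Lemma vfbr X Y f : lie_bracket X Y f = X (Y f) - Y (X f) :> C.
Proof. by []. Qed.

Definition vfE := (vf0, vfD, vfN, vfZ, vfbr).

Lemma derivationM X f k : X (f * k) = f * X k + k * X f :> C.
Proof. by have /asboolP[_ ->] := vf_valP X. Qed.

Lemma derivationD X f k : X (f + k) = X f + X k :> C.
Proof.
have /asboolP[lX _] := vf_valP X.
by have := lX 1 f k; rewrite smooth_cst1 !mul1r.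
Qed.

Lemma derivation_cst X c : X (smooth_cst M c) = 0 :> C.
Proof.
have X0 : X 0 = 0 :> C by apply: (@addrI _ (X 0)); rewrite -derivationD !addr0.
have X1 : X 1 = 0 :> C.
  apply: (@addrI _ (X 1)); rewrite addr0.
  by rewrite -[in RHS](mulr1 1) derivationM !mul1r.
have /asboolP[lX _] := vf_valP X.
by have := lX c 1 0; rewrite mulr1 X0 X1 mulr0 !addr0.
Qed.

Lemma derivationN X f : X (- f) = - X f :> C.
Proof.
by rewrite -mulN1r derivationM -smooth_cst1 -smooth_cstN derivation_cst
  mulr0 addr0 smooth_cstN smooth_cst1 mulN1r.
Qed.

Definition derivationE :=
  (derivationM, derivationD, derivationN, derivation_cst).

(** A linear identity between vector fields is checked after applying both
    sides to an arbitrary function, in the commutative ring of functions. *)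
Ltac vf_ring := apply: vf_ext => ?; rewrite ?(vfE, derivationE); ring.

Lemma lie_bracketDl X X' Y :
  lie_bracket (X + X') Y = lie_bracket X Y + lie_bracket X' Y.
Proof. by vf_ring. Qed.

Lemma lie_bracketC X Y : lie_bracket X Y = - lie_bracket Y X.
Proof. by vf_ring. Qed.

Lemma lie_bracket_cstl c X Y :
  lie_bracket (smooth_cst M c *: X) Y = smooth_cst M c *: lie_bracket X Y.
Proof. by vf_ring. Qed.

Lemma lie_bracket_cstr c X Y :
  lie_bracket X (smooth_cst M c *: Y) = smooth_cst M c *: lie_bracket X Y.
Proof. by vf_ring. Qed.

Section BilinearForms.
Context g (bg : bilinear_form g).

Lemma bilinearDl X Y Z : g (X + Y) Z = g X Z + g Y Z.
Proof. by have /= := bg.1 Z 1 X Y; rewrite scale1r mul1r. Qed.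

Lemma bilinearDr X Y Z : g X (Y + Z) = g X Y + g X Z.
Proof. by have /= := bg.2 X 1 Y Z; rewrite scale1r mul1r. Qed.

Lemma bilinear0l Y : g 0 Y = 0.
Proof. by have /= := bg.1 Y (-1) 0 0; rewrite scaler0 addr0 mulN1r addNr. Qed.

Lemma bilinear0r X : g X 0 = 0.
Proof. by have /= := bg.2 X (-1) 0 0; rewrite scaler0 addr0 mulN1r addNr. Qed.

Lemma bilinearZl f X Y : g (f *: X) Y = f * g X Y.
Proof. by have /= := bg.1 Y f X 0; rewrite !addr0 bilinear0l addr0. Qed.

Lemma bilinearZr f X Y : g X (f *: Y) = f * g X Y.
Proof. by have /= := bg.2 X f Y 0; rewrite !addr0 bilinear0r addr0. Qed.

Lemma bilinearNl X Y : g (- X) Y = - g X Y.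
Proof. by rewrite -scaleN1r bilinearZl mulN1r. Qed.

Lemma bilinearNr X Y : g X (- Y) = - g X Y.
Proof. by rewrite -scaleN1r bilinearZr mulN1r. Qed.

Definition bilinearE :=
  (bilinearDl, bilinearDr, bilinearNl, bilinearNr, bilinearZl, bilinearZr,
   bilinear0l, bilinear0r).

End BilinearForms.

Lemma nondegenerate_eq0 g X :
  nondegenerate g -> (forall Y, g X Y = 0) -> X = 0.
Proof.
move=> ndg gX; apply: vf_ext => f; apply/val_inj/funext => p.
by apply: ndg => Y; rewrite gX.
Qed.

Lemma nondegenerate_inj g X Y : bilinear_form g -> nondegenerate g ->
  (forall Z, g X Z = g Y Z) -> X = Y.
Proof.
move=> bg ndg gXY; apply/subr0_eq/(nondegenerate_eq0 ndg) => Z.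
by rewrite !(bilinearE bg) gXY subrr.
Qed.

(** By the braid relation (1 2)(2 3)(1 2) = (2 3)(1 2)(2 3), the reversal of the
    arguments acts on phi both by -1 and by +1. The restriction to L serves for
    the sections of a single eigenbundle. *)
Lemma symmetric_skew_eq0 (T : Type) (L : set T) (phi : T -> T -> T -> C) :
  (forall x y z, L x -> L y -> L z -> phi x y z = phi y x z) ->
  (forall x y z, L x -> L y -> L z -> phi x y z = - phi x z y) ->
  forall x y z, L x -> L y -> L z -> phi x y z = 0.
Proof.
move=> sym skew x y z Lx Ly Lz; apply: (@double_eq0 C^o).
have {2}-> : phi x y z = - phi x y z; last exact: subrr.
rewrite {1}sym// skew// sym// skew// sym// !opprK.
by rewrite skew.
Qed.

Lemma connectionDl D : affine_connection D ->
  forall X X' Y, D (X + X') Y = D X Y + D X' Y.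
Proof.
move=> cD X X' Y.
by have /= := connection_linear cD Y 1 X X'; rewrite !scale1r.
Qed.

Lemma connection_cst D : affine_connection D ->
  forall c X Y, D X (smooth_cst M c *: Y) = smooth_cst M c *: D X Y.
Proof.
move=> cD c X Y.
by rewrite (connection_leibniz cD) derivation_cst scale0r add0r.
Qed.

Lemma torsionDl D X X' Y : affine_connection D ->
  torsion D (X + X') Y = torsion D X Y + torsion D X' Y.
Proof.
move=> cD; rewrite /torsion lie_bracketDl (connectionDl cD).
rewrite (connection_additive cD); vf_ring.
Qed.

Lemma torsionC D X Y : torsion D X Y = - torsion D Y X.
Proof. by rewrite /torsion (lie_bracketC Y X); vf_ring. Qed.

Lemma torsionDr D X Y Y' : affine_connection D ->
  torsion D X (Y + Y') = torsion D X Y + torsion D X Y'.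
Proof. by move=> cD; rewrite torsionC torsionDl// opprD -!torsionC. Qed.

Lemma torsion_free D X Y : torsion D X Y = 0 -> lie_bracket X Y = D X Y - D Y X.
Proof. by move/subr0_eq. Qed.

(** The derivative X (g Y Z) does not depend on the connection, and cancels in
    the difference. *)
Lemma parallel_diff_skew g D1 D2 X Y Z : pseudo_riemannian g ->
  parallel D1 g -> parallel D2 g ->
  g (D1 X Y - D2 X Y) Z = - g (D1 X Z - D2 X Z) Y.
Proof.
move=> [bg sg _] p1 p2; have := p1 X Y Z; rewrite p2 => E.
rewrite (sg _ Y) !(bilinearE bg).
by apply/subr0_eq; rewrite [LHS](_ : _ =
  (g (D1 X Y) Z + g Y (D1 X Z)) - (g (D2 X Y) Z + g Y (D2 X Z)));
  [rewrite E subrr | ring].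
Qed.

(** The difference tensor is symmetric because both torsions vanish, and skew
    because both connections are metric. *)
Lemma levi_civita_unique g D1 D2 : pseudo_riemannian g ->
  levi_civita g D1 -> levi_civita g D2 -> D1 = D2.
Proof.
move=> rg [c1 p1 t1] [c2 p2 t2].
pose phi X Y Z := g (D1 X Y - D2 X Y) Z.
have phi0 X Y Z : phi X Y Z = 0.
  apply: (@symmetric_skew_eq0 _ setT) => // {}X {}Y {}Z _ _ _.
    rewrite /phi; congr (g _ _).
    have := torsion_free (t1 X Y); rewrite (torsion_free (t2 X Y)) => E.
    apply/subr0_eq.
    by rewrite -[RHS](subrr (D1 X Y - D1 Y X)) -{2}E; vf_ring.
  by rewrite /phi (parallel_diff_skew _ _ _ rg p1 p2).
have [bg _ ndg] := rg.
apply/funext => X; apply/funext => Y; apply/subr0_eq.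
exact: (nondegenerate_eq0 ndg) (phi0 X Y).
Qed.

(** T is determined by the two parallel forms g and h, hence is parallel. *)
Lemma parallel_commute g h D (T : VF -> VF) : pseudo_riemannian g ->
  (forall X Y, g (T X) Y = h X Y) -> parallel D g -> parallel D h ->
  forall X Y, D X (T Y) = T (D X Y).
Proof.
move=> [bg sg ndg] gT pg ph X Y; apply: (nondegenerate_inj bg ndg) => Z.
by apply: (@addIr _ (g (T Y) (D X Z))); rewrite -pg !gT ph.
Qed.

Lemma commute_parallel g h D (T : VF -> VF) :
  (forall X Y, g (T X) Y = h X Y) -> parallel D g ->
  (forall X Y, D X (T Y) = T (D X Y)) -> parallel D h.
Proof. by move=> gT pg cT X Y Z; rewrite -!gT pg cT. Qed.

Lemma two_form_skew w X Y : two_form w -> w X Y = - w Y X.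
Proof.
move=> [bw aw]; apply/subr0_eq.
by have := aw (X + Y); rewrite !(bilinearE bw) !aw add0r addr0 opprK.
Qed.

(** In dw, the derivatives of w are expanded by parallelism and each bracket is
    D X Y - D Y X up to torsion; everything but the torsion cancels. *)
Lemma exterior_derivative_torsion w D X Y Z : two_form w -> parallel D w ->
  exterior_derivative w X Y Z =
  w (torsion D X Y) Z + w (torsion D Y Z) X + w (torsion D Z X) Y.
Proof.
move=> tw pw; have bw := tw.1.
rewrite /exterior_derivative !pw /torsion !(bilinearE bw).
rewrite (two_form_skew Y) // (two_form_skew Z) // (two_form_skew X (D Z Y)) //.
ring.
Qed.

(** The generalized torsion of D relative to D0 is
    phi X Y Z - phi Y X Z + phi Z X Y, where skewness turns the middle term
    into phi Y Z X. *)
Lemma vanishing_generalized_torsion_cyclic g D0 D : pseudo_riemannian g ->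
  parallel D0 g -> parallel D g ->
  let phi X Y Z := g (D X Y - D0 X Y) Z in
  vanishing_generalized_torsion g D0 D <->
  forall X Y Z, phi X Y Z + phi Y Z X + phi Z X Y = 0.
Proof.
move=> rg p0 p phi; have [bg sg _] := rg.
have E X Y Z : phi X Y Z + phi Y Z X + phi Z X Y =
  (g (D X Y - D Y X) Z + g (D Z X) Y) - (g (D0 X Y - D0 Y X) Z + g (D0 Z X) Y).
  rewrite [phi Y Z X]/phi (parallel_diff_skew _ _ _ rg p p0) /phi.
  by rewrite !(bilinearE bg); ring.
split=> V X Y Z; first by rewrite E V subrr.
by apply/subr0_eq; rewrite -E V.
Qed.

(** Every X is half of X + A X, a section of the (+1)-eigenbundle, plus half of
    X - A X, a section of the (-1)-eigenbundle. Additivity suffices: this is how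
    each identity below is reduced to eigensections, one argument at a time. *)
Lemma involution_eigen_eq0 (V : zmodType) (A : {linear VF -> VF})
    (F : VF -> V) :
  (forall X, A (A X) = X) -> (forall X Y, F (X + Y) = F X + F Y) ->
  (forall c X, c * c = 1 -> eigenbundle A c X -> F X = 0) ->
  forall X, F X = 0.
Proof.
move=> AA FD F0 X.
have -> : X = smooth_half *: (X + A X) + smooth_half *: (X - A X).
  by rewrite -scalerDr addrACA subrr addr0 half_double.
rewrite FD (F0 1) ?(F0 (-1)) ?addr0 ?mulr1 ?mulrNN ?mulr1//.
  rewrite /eigenbundle /= smooth_cstN smooth_cst1 scaleN1r -scalerN opprB.
  by rewrite linearZ_LR linearB /= AA.
by rewrite /eigenbundle /= smooth_cst1 scale1r linearZ_LR linearD /= AA addrC.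
Qed.

(** On eigensections the Nijenhuis tensor of A is 2 (T - c A T), with T the
    bracket. *)
Lemma lie_bracket_eigen (A : {linear VF -> VF}) c X Y :
  (forall X, A (A X) = X) -> c * c = 1 -> integrable_field A ->
  eigenbundle A c X -> eigenbundle A c Y -> eigenbundle A c (lie_bracket X Y).
Proof.
move=> AA cc NA LX LY; rewrite /eigenbundle /=.
have := NA X Y; rewrite /nijenhuis LX LY AA.
rewrite !(lie_bracket_cstl, lie_bracket_cstr) linearZ_LR scalerA.
rewrite smooth_cst_sign//.
set T := lie_bracket X Y; rewrite scale1r -addrA -opprD /= => /subr0_eq E.
have {}E : T = smooth_cst M c *: A T.
  by rewrite -[LHS]half_double E half_double linearZ_LR.
by rewrite [in RHS]E scalerA smooth_cst_sign// scale1r.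
Qed.

(** * The algebra of the recursion operators *)

Section BornAlgebra.
Context {g h w : VF -> VF -> C} {A B J : {linear VF -> VF}}
  (born : born_structure g h w A B J).

Let rg := born_g born.
Let bg : bilinear_form g. Proof. by have [] := rg. Qed.
Let sg X Y : g X Y = g Y X. Proof. by have [_ ->] := rg. Qed.
Let ndg : nondegenerate g. Proof. by have [] := rg. Qed.
Let AA := born_AA born.
Let BB := born_BB born.

Lemma born_A_skew X Y : g (A X) Y = - g X (A Y).
Proof.
by rewrite (sg X) !(born_A born); exact: two_form_skew (born_w born).
Qed.

Lemma born_B_sym X Y : g (B X) Y = g X (B Y).
Proof. by rewrite (sg X) !(born_B born); have [_ ->] := born_h born. Qed.

Lemma born_J_AB X : J X = - A (B X).
Proof.
suff <- : A (- J X) = B X by rewrite AA opprK.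
apply: (nondegenerate_inj bg ndg) => Z.
by rewrite (born_A born) (born_J born) (born_B born).
Qed.

Lemma born_AB X : A (B X) = - B (A X).
Proof.
have := born_JJ born X; rewrite !born_J_AB !linearN /= opprK.
by move=> /(congr1 (B \o A)) /=; rewrite AA BB !linearN.
Qed.

Lemma born_J_BA X : J X = B (A X).
Proof. by rewrite born_J_AB born_AB opprK. Qed.

Lemma born_BB_isometry X Y : g (B X) (B Y) = g X Y.
Proof. by rewrite born_B_sym BB. Qed.

Lemma eigenbundle_swap c X : eigenbundle A c X -> eigenbundle A (- c) (B X).
Proof.
rewrite /eigenbundle /= => LX.
by rewrite born_AB LX linearZ_LR smooth_cstN scaleNr.
Qed.

(** A is a g-anti-isometry, and acts on both arguments by the same sign. *)
Lemma eigenbundle_isotropic c X Y : c * c = 1 ->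
  eigenbundle A c X -> eigenbundle A c Y -> g X Y = 0.
Proof.
move=> cc LX LY; apply: (@double_eq0 C^o).
have {1}-> : g X Y = - g (A X) (A Y) by rewrite born_A_skew AA opprK.
by rewrite LX LY !(bilinearE bg) mulrA smooth_cst_sign// mul1r addNr.
Qed.

(** * Integrability on the eigenbundles *)

(** The common content of the three pairs of integrability conditions. When A is
    integrable, [X,Y] lies in L_c and [BX,BY] in L_(-c), and the identity is the
    L_c-component of N_B(X,Y) = 0 or of N_J(X,Y) = 0. When B and J are
    integrable it is N_B(X,Y) - N_J(X,Y) = 0, because J = cB on L_c removes
    [BX,BY] from the difference. *)
Lemma born_lie_bracket c X Y : integrable_born w A B J -> c * c = 1 ->
  eigenbundle A c X -> eigenbundle A c Y ->
  let W := lie_bracket (B X) Y + lie_bracket X (B Y) in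
  lie_bracket X Y + lie_bracket X Y = B (W - smooth_cst M c *: A W).
Proof.
move=> [_ int] cc LX LY W.
have LBX := eigenbundle_swap LX; have LBY := eigenbundle_swap LY.
have JX : J X = smooth_cst M c *: B X by rewrite born_J_BA LX linearZ_LR.
have JY : J Y = smooth_cst M c *: B Y by rewrite born_J_BA LY linearZ_LR.
have NBE : nijenhuis B X Y = lie_bracket (B X) (B Y) + lie_bracket X Y - B W.
  by rewrite /nijenhuis BB linearD opprD addrA.
have NJE : nijenhuis J X Y = lie_bracket (B X) (B Y) - lie_bracket X Y
    - smooth_cst M c *: B (A W).
  rewrite /nijenhuis (born_JJ born) JX JY !(lie_bracket_cstl, lie_bracket_cstr).
  rewrite scalerA smooth_cst_sign// scale1r !linearZ_LR /= !born_J_BA.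
  by rewrite /W !linearD /= addrA.
have eig : integrable_field A ->
    eigenbundle A c (lie_bracket X Y) /\
    eigenbundle A (- c) (lie_bracket (B X) (B Y)).
  move=> NA; split; first exact: lie_bracket_eigen.
  by apply: lie_bracket_eigen => //; rewrite mulrNN.
case: int => [[NA NB]|[NA NJ]|[NB NJ]].
- have [E1 E2] := eig NA.
  have := NB X Y; rewrite NBE => /subr0_eq E.
  (* Adding c A to this equation extracts twice its L_c-component. *)
  have := congr1 A E.
  rewrite linearD /= E1 E2 smooth_cstN scaleNr born_AB => E'.
  have := congr1 (fun Z => smooth_cst M c *: Z) E'.
  rewrite scalerDr scalerN !scalerA smooth_cst_sign// !scale1r scalerN => {}E'.
  rewrite linearB linearZ_LR /= -E -E'; vf_ring.
- have [E1 E2] := eig NA.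
  have := NJ X Y; rewrite NJE => /subr0_eq E.
  have := congr1 A E.
  rewrite linearB linearZ_LR /= E1 E2 smooth_cstN scaleNr born_AB AA => E'.
  have := congr1 (fun Z => smooth_cst M c *: Z) E'.
  rewrite scalerBr !scalerN !scalerA smooth_cst_sign// !scale1r => {}E'.
  have {}E' : B W = lie_bracket (B X) (B Y) + lie_bracket X Y.
    by rewrite -[LHS]opprK -E' opprB opprK addrC.
  rewrite linearB linearZ_LR /= -E E'; vf_ring.
- have := NB X Y; rewrite NBE => /subr0_eq E.
  have := NJ X Y; rewrite NJE => /subr0_eq E'.
  rewrite linearB linearZ_LR /= -E -E'; vf_ring.
Qed.

(** In [born_lie_bracket], 1 - cA takes values in L_(-c), which B maps to
    L_c. *)
Lemma born_eigen_involutive c X Y : integrable_born w A B J -> c * c = 1 ->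
  eigenbundle A c X -> eigenbundle A c Y -> eigenbundle A c (lie_bracket X Y).
Proof.
move=> int cc LX LY; rewrite /eigenbundle /=.
pose W := lie_bracket (B X) Y + lie_bracket X (B Y).
have E' : lie_bracket X Y = smooth_half *: B (W - smooth_cst M c *: A W).
  by rewrite -(born_lie_bracket int cc LX LY) half_double.
rewrite E' linearZ_LR /= born_AB linearB linearZ_LR /= AA -linearN opprB.
rewrite [RHS]scalerA mulrC -scalerA; congr (_ *: _).
by rewrite -linearZ_LR /= scalerBr scalerA smooth_cst_sign// scale1r.
Qed.

(** * The Künneth connection is the Levi-Civita connection of g *)

Section Kunneth.
Context {DK : VF -> VF -> VF} (integrable : integrable_born w A B J)
  (kunneth : kunneth_connection w (eigenbundle A 1) (eigenbundle A (-1)) DK).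

Let cK : affine_connection DK. Proof. by case: kunneth. Qed.

Lemma kunneth_preserves c X Y : c * c = 1 ->
  eigenbundle A c Y -> eigenbundle A c (DK X Y).
Proof.
by case: kunneth => _ pp pm _ _ /sign_cases[] ->; [exact: pp|exact: pm].
Qed.

Lemma kunneth_A X Y : DK X (A Y) = A (DK X Y).
Proof.
apply/subr0_eq; move: Y; apply: (involution_eigen_eq0 AA) => [Y Y'|c Y cc LY].
  by rewrite linearD !(connection_additive cK) linearD opprD addrACA.
by rewrite (kunneth_preserves _ cc LY) LY (connection_cst cK) subrr.
Qed.

Lemma kunneth_parallel_g : parallel DK g.
Proof.
have [_ _ _ pw _] := kunneth.
by apply: (commute_parallel _ pw kunneth_A) => X Y; rewrite -(born_A born) AA.
Qed.

(** The torsion vanishes on L_+ x L_- by definition of DK. For X and Y in L_c it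
    lies in the involutive bundle L_c, so it is w-orthogonal to L_c by isotropy;
    it is w-orthogonal to L_(-c) because the other two terms of dw = 0 are mixed
    torsions. *)
Lemma kunneth_torsion_free X Y : torsion DK X Y = 0.
Proof.
have [_ _ _ pw t0] := kunneth.
have tmix c X' Y' : c * c = 1 -> eigenbundle A c X' -> eigenbundle A (- c) Y' ->
    torsion DK X' Y' = 0.
  move=> /sign_cases[] ->; first exact: t0.
  by rewrite opprK torsionC => LX LY; rewrite t0 ?oppr0.
move: Y; apply: (involution_eigen_eq0 AA) => [Y Y'|d Y dd LY];
  first exact: torsionDr.
move: X; apply: (involution_eigen_eq0 AA) => [X X'|c X cc LX];
  first exact: torsionDl.
have [dc|dc] := sign_eq_or_opp cc dd.
- subst d; apply: (nondegenerate_eq0 (born_w_nondegenerate born)) => Z.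
  have bw := (born_w born).1.
  have LT : eigenbundle A c (torsion DK X Y).
    rewrite /eigenbundle /torsion /= !linearB /=.
    rewrite (kunneth_preserves X cc LY) (kunneth_preserves Y cc LX).
    by rewrite (born_eigen_involutive integrable cc LX LY).
  move: Z; apply: (involution_eigen_eq0 AA) => [Z Z'|e Z ee LZ].
    by rewrite !(bilinearE bw).
  have [ec|ec] := sign_eq_or_opp cc ee.
  + rewrite ec in LZ.
    rewrite -(born_A born) LT (bilinearZl bg).
    by rewrite (eigenbundle_isotropic cc LT LZ) mulr0.
  + have := exterior_derivative_torsion X Y Z (born_w born) pw.
    rewrite ec in LZ.
    rewrite integrable.1 (torsionC _ Z X).
    rewrite (tmix c Y Z cc LY LZ) (tmix c X Z cc LX LZ).
    by rewrite oppr0 !(bilinear0l bw) !addr0.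
- by apply: (tmix c) => //; rewrite -dc.
Qed.

Lemma kunneth_levi_civita : levi_civita g DK.
Proof.
by split; [exact: cK|exact: kunneth_parallel_g|exact: kunneth_torsion_free].
Qed.

Lemma kunneth_canonical : canonical_connection A DK = DK.
Proof.
apply/funext => X; apply/funext => Y.
by rewrite /canonical_connection kunneth_A AA half_double.
Qed.

(** [born_lie_bracket] with the brackets expanded by DK: the operator 1 - cA
    kills the terms DK (B X) Y and DK (B Y) X, which lie in L_c, and doubles the
    other two. *)
Lemma kunneth_lie_bracket c X Y : c * c = 1 ->
  eigenbundle A c X -> eigenbundle A c Y ->
  lie_bracket X Y = B (DK X (B Y)) - B (DK Y (B X)).
Proof.
move=> cc LX LY; have := born_lie_bracket integrable cc LX LY => /=.
rewrite (torsion_free (kunneth_torsion_free (B X) Y)).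
rewrite (torsion_free (kunneth_torsion_free X (B Y))) => E.
rewrite -[LHS]half_double E -linearB -[RHS]half_double -linearD.
congr (_ *: B _).
have cc' : - c * - c = 1 by rewrite mulrNN.
have LBX := eigenbundle_swap LX; have LBY := eigenbundle_swap LY.
have -> U V U' V' : A (U - V + (U' - V')) = A U - A V + (A U' - A V').
  by rewrite linearD !linearB.
rewrite (kunneth_preserves (B X) cc LY) (kunneth_preserves (B Y) cc LX).
rewrite (kunneth_preserves X cc' LBY) (kunneth_preserves Y cc' LBX).
rewrite smooth_cstN !(scalerBr, scalerDr) !scalerA mulrN smooth_cst_sign//.
by vf_ring.
Qed.

(** * The averaged connection *)

Let D X Y := smooth_half *: (DK X Y + B (DK X (B Y))).

Lemma born_average_connection : affine_connection D.
Proof.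
split=> [Y f X X'|X Y Z|X f Y]; rewrite /D.
- rewrite !(connection_linear cK) linearP; rewrite /=; vf_ring.
- rewrite [B (Y + Z)]linearD !(connection_additive cK) [B (_ + _)]linearD.
  by vf_ring.
- have BZ k Z : B (k *: Z) = k *: B Z by rewrite linearZ_LR.
  rewrite BZ !(connection_leibniz cK) [B (_ + _)]linearD !BZ BB.
  by rewrite addrACA scalerDr half_double -scalerDr !scalerA mulrC.
Qed.

Lemma born_average_B X Y : D X (B Y) = B (D X Y).
Proof. by rewrite /D [in RHS]linearZ_LR [B (_ + _)]linearD !BB addrC. Qed.

Lemma born_average_A X Y : D X (A Y) = A (D X Y).
Proof.
rewrite /D [in RHS]linearZ_LR [A (_ + _)]linearD kunneth_A; congr (_ *: (_ + _)).
have -> : B (A Y) = - A (B Y) by rewrite born_AB opprK.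
by rewrite -scaleN1r -smooth_cst1 -smooth_cstN (connection_cst cK) kunneth_A
  linearZ_LR /= smooth_cstN smooth_cst1 scaleN1r -born_AB.
Qed.

Lemma born_average_parallel_g : parallel D g.
Proof.
move=> X Y Z; rewrite /D !(bilinearE bg) born_B_sym -(born_B_sym Y).
rewrite -[LHS](half_double (V := C^o)) {1}kunneth_parallel_g.
rewrite -(born_BB_isometry Y Z) kunneth_parallel_g /GRing.scale /=.
ring.
Qed.

Lemma born_average_compatible : compatible g h w D.
Proof.
split; first exact: born_average_connection.
- exact: born_average_parallel_g.
- exact: commute_parallel (born_B born) born_average_parallel_g born_average_B.
- exact: commute_parallel (born_A born) born_average_parallel_g born_average_A.
Qed.

(** D X Y - D Y X is the mean of two expressions of the bracket: the one given
    by DK and the one of [kunneth_lie_bracket]. *)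
Lemma born_average_torsion c X Y : c * c = 1 ->
  eigenbundle A c X -> eigenbundle A c Y -> torsion D X Y = 0.
Proof.
move=> cc LX LY; rewrite /torsion /D.
rewrite -[X in _ - X]half_double {1}(kunneth_lie_bracket cc LX LY).
by rewrite (torsion_free (kunneth_torsion_free X Y)); vf_ring.
Qed.

(** The cyclic sum of phi vanishes when its first two arguments lie in the same
    L_c; by cyclicity, the other coincidences of signs reduce to this one. *)
Lemma born_average_generalized_torsion : vanishing_generalized_torsion g DK D.
Proof.
apply/(vanishing_generalized_torsion_cyclic rg kunneth_parallel_g
         born_average_parallel_g).
have cD := born_average_connection.
set phi := fun X Y Z => g (D X Y - DK X Y) Z.
pose Phi X Y Z := phi X Y Z + phi Y Z X + phi Z X Y.
have PhiC X Y Z : Phi X Y Z = Phi Y Z X by rewrite /Phi; ring.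
have PhiD X Y Z Z' : Phi X Y (Z + Z') = Phi X Y Z + Phi X Y Z'.
  rewrite /Phi /phi !(connectionDl cD) !(connectionDl cK).
  rewrite !(connection_additive cD) !(connection_additive cK) !(bilinearE bg).
  ring.
have Phi0 c X Y Z : c * c = 1 -> eigenbundle A c X -> eigenbundle A c Y ->
    Phi X Y Z = 0.
  move=> cc LX LY; rewrite /Phi.
  (* D - DK commutes with A, so it keeps X in the isotropic bundle of Y. *)
  have -> : phi Z X Y = 0.
    apply: (eigenbundle_isotropic cc) => //; rewrite /eigenbundle /=.
    by rewrite linearB /= -born_average_A -kunneth_A LX
      (connection_cst cD) (connection_cst cK) scalerBr.
  have -> : phi Y Z X = - phi Y X Z.
    exact: parallel_diff_skew rg born_average_parallel_g kunneth_parallel_g.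
  rewrite addr0 /phi -(bilinearNl bg) -(bilinearDl bg).
  rewrite [X in g X Z](_ : _ = 0) ?(bilinearE bg)//.
  transitivity (torsion D X Y - torsion DK X Y).
    by rewrite /torsion; vf_ring.
  by rewrite kunneth_torsion_free (born_average_torsion cc LX LY) subrr.
move=> X Y Z; rewrite -[LHS]/(Phi X Y Z).
move: Z; apply: (involution_eigen_eq0 AA) => [Z Z'|e Z ee LZ]; first exact: PhiD.
rewrite PhiC PhiC; move: Y.
apply: (involution_eigen_eq0 AA) => [Y Y'|d Y dd LY]; first exact: PhiD.
rewrite PhiC PhiC; move: X.
apply: (involution_eigen_eq0 AA) => [X X'|c X cc LX]; first exact: PhiD.
have [de|ec|cd] : [\/ d = e, e = c | c = d].
- by case: (sign_cases cc) (sign_cases dd) (sign_cases ee) => -> [] -> [] ->;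
    (apply: Or31 + apply: Or32 + apply: Or33); reflexivity.
- by apply: (Phi0 d) => //; rewrite de.
- by rewrite PhiC; apply: (Phi0 e) => //; rewrite ec.
- by rewrite PhiC PhiC; apply: (Phi0 c) => //; rewrite cd.
Qed.

End Kunneth.

(** * Uniqueness of the Born connection *)

(** For X and Y in L_c, isotropy kills one term of the cyclic sum and leaves
    S X Y = S Y X. Then h(S X Y, Z), that is g(B (S X Y), Z), is zero on L_c by
    [symmetric_skew_eq0] and on L_(-c) by isotropy. A section Y of the other
    eigenbundle is B (B Y), with B Y in L_c and S commuting with B. *)
Lemma born_connection_unique D1 D2 : compatible g h w D1 ->
  compatible g h w D2 -> vanishing_generalized_torsion g D2 D1 -> D1 = D2.
Proof.
move=> [c1 pg1 ph1 pw1] [c2 pg2 ph2 pw2].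
move=> /(vanishing_generalized_torsion_cyclic rg pg2 pg1) /= cyc.
pose S X Y : VF := D1 X Y - D2 X Y.
have SA X Y : S X (A Y) = A (S X Y).
  rewrite /S linearB (parallel_commute rg (born_A born) pg1 pw1).
  by rewrite (parallel_commute rg (born_A born) pg2 pw2).
have SB X Y : S X (B Y) = B (S X Y).
  rewrite /S linearB (parallel_commute rg (born_B born) pg1 ph1).
  by rewrite (parallel_commute rg (born_B born) pg2 ph2).
have SZ c X Y : S X (smooth_cst M c *: Y) = smooth_cst M c *: S X Y.
  by rewrite /S (connection_cst c1) (connection_cst c2) scalerBr.
have S_eigen c X Y : eigenbundle A c Y -> eigenbundle A c (S X Y).
  by move=> LY; rewrite /eigenbundle /= -SA LY SZ.
have S_sym c X Y : c * c = 1 -> eigenbundle A c X -> eigenbundle A c Y ->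
    S X Y = S Y X.
  move=> cc LX LY; apply: (nondegenerate_inj bg ndg) => Z.
  have := cyc X Y Z; rewrite -/(S _ _) -/(S _ _) -/(S _ _).
  rewrite (eigenbundle_isotropic cc (S_eigen _ Z _ LX) LY) addr0.
  rewrite [X in _ + X](parallel_diff_skew _ _ _ rg pg1 pg2).
  exact: subr0_eq.
have S_same c X Y : c * c = 1 -> eigenbundle A c X -> eigenbundle A c Y ->
    S X Y = 0.
  move=> cc LX LY.
  apply: (nondegenerate_eq0 ndg) => Z; rewrite -(BB Z) -born_B_sym.
  move: {Z}(B Z); apply: (involution_eigen_eq0 AA) => [Z Z'|d Z dd LZ].
    by rewrite (bilinearDr bg).
  have [dc|dc] := sign_eq_or_opp cc dd.
  - rewrite dc in LZ.
    apply: (@symmetric_skew_eq0 _ (eigenbundle A c)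
      (fun X Y Z => g (B (S X Y)) Z)) LX LY LZ => {}X {}Y {}Z LX LY LZ.
      by rewrite (S_sym c).
    rewrite -SB [LHS](parallel_diff_skew _ _ _ rg pg1 pg2) -/(S _ _).
    by rewrite -born_B_sym.
  - rewrite dc in LZ; apply: (eigenbundle_isotropic _ _ LZ); rewrite ?mulrNN//.
    exact/eigenbundle_swap/S_eigen.
apply/funext => X; apply/funext => Y; apply/subr0_eq; rewrite -[LHS]/(S X Y).
move: Y; apply: (involution_eigen_eq0 AA) => [Y Y'|d Y dd LY].
  rewrite /S (connection_additive c1) (connection_additive c2); vf_ring.
move: X; apply: (involution_eigen_eq0 AA) => [X X'|c X cc LX].
  rewrite /S (connectionDl c1) (connectionDl c2); vf_ring.
have [dc|dc] := sign_eq_or_opp cc dd.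
- by apply: (S_same c) => //; rewrite -dc.
- have LBY := eigenbundle_swap LY; rewrite dc opprK in LBY.
  by rewrite -(BB Y) SB (S_same c)// linear0.
Qed.

End BornAlgebra.
End Calculus.

Theorem theorem34 (R : realType) (n : nat) (M : smooth_manifold R n)
    (g h w : vector_field M -> vector_field M -> smooth_fun M)
    (A B J : {linear vector_field M -> vector_field M})
    (DK : vector_field M -> vector_field M -> vector_field M)
    (born : born_structure g h w A B J)
    (integrable : integrable_born w A B J)
    (kunneth : kunneth_connection w (eigenbundle A 1) (eigenbundle A (-1)) DK) :
  let D := fun X Y => smooth_half *: (DK X Y + B (DK X (B Y))) in
  (forall X Y, D X Y = smooth_half *: (DK X Y - J (DK X (J Y)))) /\
  born_connection g h w A D /\
  (forall DB, born_connection g h w A DB -> DB = D).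
Proof.
move=> D.
have compD : compatible g h w D := born_average_compatible born kunneth.
have lcK := kunneth_levi_civita born integrable kunneth.
have gtD := born_average_generalized_torsion born integrable kunneth.
split=> [X Y|].
  congr (_ *: (_ + _)).
  rewrite (born_J_AB born (DK _ _)) (born_J_BA born Y) opprK.
  have -> : B (A Y) = - A (B Y) by rewrite (born_AB born) opprK.
  rewrite -scaleN1r -smooth_cst1 -smooth_cstN.
  have [cK _ _ _ _] := kunneth.
  rewrite (connection_cst cK) (kunneth_A born kunneth) smooth_cstN smooth_cst1.
  by rewrite scaleN1r !linearN /= (born_AB born (A _)) (born_AA born) opprK.
split.
  split=> //; exists DK => //.
  by rewrite (kunneth_canonical born kunneth).
move=> DB [compDB [Dg lcg gtDB]].
apply: (born_connection_unique born compDB compD) => X Y Z.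
rewrite gtDB (levi_civita_unique (born_g born) lcg lcK).
by rewrite (kunneth_canonical born kunneth) gtD.
Qed.
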